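(* Let $k\ge 1$ and $n\ge 2$ be integers and $0<\varepsilon<1$. Each site $i\in[k]$ holds a vector $v^{(i)}=(v_{i1},\dots,v_{in})$ with non-negative integer entries bounded by $\mathrm{poly}(n)$, and let $v=\sum_{i=1}^k v^{(i)}$, so $v_j=\sum_{i=1}^k v_{ij}$. Consider the following one-round protocol. Each site $i$ computes $F_2(v^{(i)})=\sum_{j=1}^n v_{ij}^2$ and, for each $j\in[n]$, sets $p_{ij}=\min\{1,\ \frac{3v_{ij}^2}{\varepsilon^2F_2(v^{(i)})}\}$ and independently sends $v_{ij}$ to the coordinator with probability $p_{ij}$. The coordinator outputs, for each $j\in[n]$, $\hat v_j=\sum_{i=1}^k \frac{v_{ij}}{p_{ij}}\cdot\mathbf 1(\text{site } i \text{ sent } v_{ij})$. Then for each $j\in[n]$, with probability at least $2/3$, $|\hat v_j-v_j|\le \varepsilon\,\ell_2'(v)$, where $\ell_2'(v)=\big(\sum_{i=1}^k\sum_{j=1}^n v_{ij}^2\big)^{1/2}$. The expected communication cost is $O\!\left(\frac{k\log n}{\varepsilon^2}\right)$ bits.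
   Context: Coordinator model: there are $k$ sites and one coordinator; site $i$ knows only $v^{(i)}$, and communication is measured as the total number of bits exchanged between the coordinator and all sites. Terms with $v_{ij}=0$ (so $p_{ij}=0$) contribute $0$ to $\hat v_j$. *)

(* Defs.v *)
From HB Require Import structures.
From mathcomp Require Import all_boot all_order all_algebra.
From mathcomp Require Import all_classical all_reals all_analysis.
Set Implicit Arguments.
Unset Strict Implicit.
Unset Printing Implicit Defensive.
Import Order.TTheory GRing.Theory Num.Theory.
Import numFieldNormedType.Exports.

Local Open Scope ring_scope.

(* v i : 'rV[nat]_n is the vector held by site i; its j-th entry is v i 0 j. *)

Definition F2 (n : nat) (x : 'rV[nat]_n) : nat := (\sum_(j < n) x ord0 j ^ 2)%N.

Definition ell2' (R : realType) (k n : nat) (v : 'I_k -> 'rV[nat]_n) : R :=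
  Num.sqrt (\sum_(i < k) \sum_(j < n) (v i ord0 j)%:R ^+ 2).

(* The sending probability of an entry a of a vector whose F2 equals f.  When
   f = 0 the vector is 0, and the value is 0 because 0^-1 = 0. *)
Definition send_prob (R : realType) (eps : R) (a f : nat) : R :=
  Num.min 1 (3 * a%:R ^+ 2 / (eps ^+ 2 * f%:R)).

(* When a = 0 the sending probability is 0 and the weight is 0 / 0 = 0. *)
Definition weight (R : realType) (eps : R) (a f : nat) : R :=
  a%:R / send_prob eps a f.

Definition estimate (R : realType) (k n : nat) (eps : R)
    (v : 'I_k -> 'rV[nat]_n) (sent : 'I_k -> 'I_n -> bool) (j : 'I_n) : R :=
  \sum_(i < k) weight eps (v i ord0 j) (F2 (v i)) * (sent i j)%:R.

(* The sending decisions are mutually independent over all pairs (i, j), and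
   site i sends its j-th entry with probability p_ij. *)
Definition independent_sending (R : realType) (d : measure_display)
    (T : measurableType d) (P : probability T R) (k n : nat) (eps : R)
    (v : 'I_k -> 'rV[nat]_n) (sent : 'I_k -> 'I_n -> {RV P >-> bool}) : Prop :=
  (forall i j, P [set t | sent i j t]%classic
     = (send_prob eps (v i ord0 j) (F2 (v i)))%:E) /\
  (forall A : {set 'I_k * 'I_n},
     P [set t | forall ij, ij \in A -> sent ij.1 ij.2 t]%classic
     = (\prod_(ij in A) P [set t | sent ij.1 ij.2 t]%classic)%E).

(* Bit-level messages.  The numbers n, eps and a bound B on the entries are
   public, so every field has a publicly known width. *)

Definition width (m : nat) : nat := up_log 2 m.+1.

Definition to_bits (w x : nat) : bitseq := mkseq (fun b => odd (x %/ 2 ^ b)) w.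

Definition of_bits (s : bitseq) : nat :=
  foldr (fun (b : bool) x => (b + x.*2)%N) 0%N s.

Definition index_width (n : nat) : nat := width n.
Definition entry_width (B : nat) : nat := width B.
Definition F2_width (n B : nat) : nat := width (n * B ^ 2).

(* The message of a site holding x that sends the entries with index in S.
   The header consists of the number of entries sent, which makes messages
   self-delimiting, and of F2 x, which the coordinator needs in order to know
   the probabilities.  Each entry sent is preceded by its index. *)
Definition site_message (n B : nat) (x : 'rV[nat]_n) (S : {set 'I_n}) : bitseq :=
  to_bits (index_width n) #|S| ++ to_bits (F2_width n B) (F2 x) ++
  flatten [seq to_bits (index_width n) j ++ to_bits (entry_width B) (x ord0 j)
          | j : 'I_n <- enum S].

Definition decode_entries (n B : nat) (m : bitseq) : seq (nat * nat) :=
  let count := of_bits (take (index_width n) m) in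
  let body := drop (index_width n + F2_width n B) m in
  [seq (of_bits (take (index_width n) e), of_bits (drop (index_width n) e))
  | e <- reshape (nseq count (index_width n + entry_width B)%N) body].

Definition decode_F2 (n B : nat) (m : bitseq) : nat :=
  of_bits (take (F2_width n B) (drop (index_width n) m)).

Definition coordinator (R : realType) (k n B : nat) (eps : R)
    (M : 'I_k -> bitseq) (j : 'I_n) : R :=
  \sum_(i < k) \sum_(e <- decode_entries n B (M i) | e.1 == j)
    weight eps e.2 (decode_F2 n B (M i)).

Definition transcript (k n B : nat) (v : 'I_k -> 'rV[nat]_n)
    (sent : 'I_k -> 'I_n -> bool) (i : 'I_k) : bitseq :=
  site_message B (v i) [set j | sent i j].

Definition communication (k : nat) (M : 'I_k -> bitseq) : nat :=
  (\sum_(i < k) size (M i))%N.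

(* Main.v *)
Require Import Defs.
From HB Require Import structures.
From mathcomp Require Import all_boot all_order all_algebra.
From mathcomp Require Import all_classical all_reals all_analysis.
From mathcomp Require Import measurable_realfun ring.
Set Implicit Arguments.
Unset Strict Implicit.
Unset Printing Implicit Defensive.
Import Order.TTheory GRing.Theory Num.Theory.
Import numFieldNormedType.Exports.
Local Open Scope ring_scope.

(* Each weight times its sending probability is the entry itself, so the
   estimate is unbiased.  Pairwise independence makes its variance the sum of
   the terms weight^2 p (1 - p), which vanish when p = 1 and are at most
   eps^2 F2(v_i) / 3 otherwise; Chebyshev's inequality at radius eps * ell2'
   then bounds the failure probability by 1/3.  A site sends at most 3 / eps^2
   entries on average, and every field of a message has O(log n) bits. *)

(** * Mean and variance of weighted sums of indicators, and Chebyshev's inequality *)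

Section indicator_sum.
Context (d : measure_display) (T : measurableType d) (R : realType).
Variable P : probability T R.

Lemma integrable_indic_sum (I : finType) (w : I -> R) (A : I -> set T) :
  (forall i, measurable (A i)) ->
  P.-integrable [set: T] (EFin \o (fun t => \sum_i w i * \1_(A i) t)).
Proof.
move=> mA.
rewrite (_ : _ \o _ = fun t => (\sum_i (w i)%:E * (\1_(A i) t)%:E)%E).
  apply: integrable_sum => // i _.
  exact: integrableZl (integrable_indic P (mA i)).
by apply/funext => t /=; rewrite sumEFin.
Qed.

Lemma expectation_indic_sum (I : finType) (w p : I -> R) (A : I -> set T) :
  (forall i, measurable (A i)) -> (forall i, P (A i) = (p i)%:E) ->
  ('E_P[(fun t => \sum_i w i * \1_(A i) t)%R] = (\sum_i w i * p i)%R%:E)%E.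
Proof.
move=> mA PA; rewrite unlock.
under eq_integral => t _ do rewrite -sumEFin.
rewrite integral_sum//; last first.
  by move=> i; exact: integrableZl (integrable_indic P (mA i)).
rewrite -sumEFin; apply: eq_bigr => i _.
under eq_integral => t _ do rewrite EFinM.
rewrite integralZl//; last exact: integrable_indic.
by rewrite integral_indic// setIT EFinM -PA.
Qed.

(* The square of a combination of indicators is a combination of indicators of
   pairwise intersections. *)
Lemma variance_indic_sum (I : finType) (w p : I -> R) (A : I -> set T) :
  (forall i, measurable (A i)) -> (forall i, P (A i) = (p i)%:E) ->
  (forall i j, i != j -> P (A i `&` A j)%classic = (p i * p j)%:E) ->
  ('V_P[(fun t => \sum_i w i * \1_(A i) t)%R]
    = (\sum_i w i ^+ 2 * (p i * (1 - p i)))%R%:E)%E.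
Proof.
move=> mA PA PAA; set X := fun t => _.
pose q (ij : I * I) := if ij.1 == ij.2 then p ij.1 else p ij.1 * p ij.2.
pose AA (ij : I * I) := (A ij.1 `&` A ij.2)%classic.
have mAA ij : measurable (AA ij) by exact: measurableI.
have PAAq ij : P (AA ij) = (q ij)%:E.
  rewrite /AA /q; case: ij => i j /=; case: eqVneq => [->|/PAA//].
  by rewrite setIid.
have XX : X * X = fun t => \sum_ij w ij.1 * w ij.2 * \1_(AA ij) t.
  apply/funext => t.
  transitivity ((\sum_i w i * \1_(A i) t) * (\sum_i w i * \1_(A i) t)) => //.
  rewrite mulr_suml.
  under eq_bigr do rewrite mulr_sumr.
  rewrite pair_bigA; apply: eq_bigr => -[i j] _ /=.
  by rewrite /AA indicI /= mulrACA.
rewrite /variance covarianceE.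
- rewrite XX (expectation_indic_sum _ mAA PAAq) (expectation_indic_sum _ mA PA).
  rewrite -EFinM -EFinB; congr EFin; rewrite mulr_suml.
  under [X in _ - X]eq_bigr do rewrite mulr_sumr.
  rewrite -(pair_bigA _ (fun i j => w i * w j * q (i, j)))/= -sumrB.
  (* In row [i], the off-diagonal terms cancel by pairwise independence; the diagonal one leaves
     [w i ^+ 2 * (p i - p i ^+ 2)]. *)
  apply: eq_bigr => i _; rewrite -sumrB (bigD1 i)//= big1 ?addr0.
    by rewrite /q eqxx /=; ring.
  by move=> j ji; rewrite /q /= eq_sym (negbTE ji); ring.
- by apply/Lfun1_integrable; exact: integrable_indic_sum.
- by apply/Lfun1_integrable; exact: integrable_indic_sum.
- by rewrite XX; apply/Lfun1_integrable; exact: integrable_indic_sum.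
Qed.

Lemma measurable_indic_sum (I : finType) (w : I -> R) (A : I -> set T) :
  (forall i, measurable (A i)) ->
  measurable_fun [set: T] (fun t => \sum_i w i * \1_(A i) t).
Proof.
move=> mA; apply: measurable_sum => i; exact: measurable_funM.
Qed.

(** Chebyshev's inequality passed to the complement: a deviation strictly above [r] is in particular
    a deviation of at least [r]. *)
Lemma chebyshev_within (X : T -> R) (mu s r : R) :
  measurable_fun [set: T] X -> 0 < r ->
  ('E_P[X] = mu%:E)%E -> ('V_P[X] <= s%:E)%E ->
  ((1 - s / r ^+ 2)%:E <= P [set t | (`|X t - mu| <= r)%R]%classic)%E.
Proof.
move=> mX r0 EX VX.
pose Y : {RV P >-> R} := HB.pack X (isMeasurableFun.Build _ _ _ _ X mX).
have mXmu : measurable_fun [set: T] (fun t => `|X t - mu|).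
  by apply: measurableT_comp => //; exact: measurable_funB.
have mS : measurable [set t | (`|X t - mu| <= r)%R]%classic.
  rewrite -[X in measurable X]setTI.
  exact: measurable_fun_le.
rewrite -[X in P X]setCK probability_setC; last exact: measurableC.
rewrite EFinB leeB//; apply: (@le_trans _ _
  (P [set t | r <= `|Y t - fine ('E_P[Y])%E|]%classic)).
  apply: le_measure; rewrite ?inE//=.
  - exact: measurableC.
  - rewrite EX /= -[X in measurable X]setTI.
    exact: measurable_fun_le.
  - by move=> t /= /negP; rewrite -ltNge EX => /ltW.
apply: le_trans (chebyshev Y r0) _.
by rewrite mulrC EFinM lee_wpmul2l// lee_fin invr_ge0 sqr_ge0.
Qed.

End indicator_sum.

(** * Encoding and decoding of messages *)

(** The encoding puts the least significant bit first; peeling it off matches the recursion of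
    [of_bits]. *)
Lemma to_bitsS (w x : nat) : to_bits w.+1 x = odd x :: to_bits w x./2.
Proof.
rewrite /to_bits /mkseq /= expn0 divn1 -[1%N]/(1 + 0)%N iotaDl -map_comp.
by congr cons; apply: eq_map => b /=; rewrite expnS divnMA divn2.
Qed.

Lemma to_bitsK (w x : nat) : (x < 2 ^ w)%N -> of_bits (to_bits w x) = x.
Proof.
elim: w x => [|w IH] x; first by rewrite expn0 ltnS leqn0 => /eqP ->.
move=> xw; rewrite to_bitsS /= IH ?odd_double_half//.
rewrite -ltn_double -[X in (_ < X)%N]mul2n -expnS (leq_ltn_trans _ xw)//.
by rewrite -{2}[x]odd_double_half leq_addl.
Qed.

Lemma size_to_bits (w x : nat) : size (to_bits w x) = w.
Proof. exact: size_mkseq. Qed.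

Lemma width_to_bitsK (m x : nat) : (x <= m)%N ->
  of_bits (to_bits (width m) x) = x.
Proof. by move=> xm; apply: to_bitsK; apply: leq_trans (up_logP _ _). Qed.

Section message.
Variables (n B : nat) (x : 'rV[nat]_n) (S : {set 'I_n}).
Hypothesis xB : forall j, (x ord0 j <= B)%N.

Let entry (j : 'I_n) : bitseq :=
  to_bits (index_width n) j ++ to_bits (entry_width B) (x ord0 j).

(** All entries have the same width, so the count in the header determines the shape by which
    [reshape] undoes [flatten]. *)
Let shape_entries : shape [seq entry j | j : 'I_n <- enum S]
  = nseq #|S| (index_width n + entry_width B)%N.
Proof.
rewrite /shape -map_comp cardE; elim: (enum S) => //= j s ->.
by rewrite size_cat !size_to_bits.
Qed.

Lemma size_site_message : size (site_message B x S)
  = (index_width n + F2_width n B + #|S| * (index_width n + entry_width B))%N.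
Proof.
rewrite !size_cat !size_to_bits size_flatten shape_entries sumn_nseq.
by rewrite addnA mulnC.
Qed.

Lemma decode_entriesK : decode_entries n B (site_message B x S)
  = [seq (val j, x ord0 j) | j <- enum S].
Proof.
rewrite /decode_entries /site_message take_size_cat ?size_to_bits//.
(* The count can equal [n] itself; it still fits, since [width n] bits hold every number up to and
   including [n]. *)
rewrite width_to_bitsK; last by rewrite -[X in (_ <= X)%N]card_ord max_card.
rewrite catA drop_size_cat ?size_cat ?size_to_bits// -shape_entries flattenK.
rewrite -map_comp; apply: eq_map => j /=.
rewrite take_size_cat ?drop_size_cat ?size_to_bits//.
by rewrite !width_to_bitsK // ltnW.
Qed.

Lemma F2_le : (F2 x <= n * B ^ 2)%N.
Proof.
rewrite -[X in (X * _)%N]card_ord -sum_nat_const.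
by apply: leq_sum => j _; rewrite leq_exp2r.
Qed.

Lemma decode_F2K : decode_F2 n B (site_message B x S) = F2 x.
Proof.
rewrite /decode_F2 /site_message drop_size_cat ?size_to_bits//.
by rewrite take_size_cat ?size_to_bits// width_to_bitsK// F2_le.
Qed.

End message.

Lemma coordinator_transcript (R : realType) (k n B : nat) (eps : R)
    (v : 'I_k -> 'rV[nat]_n) (sent : 'I_k -> 'I_n -> bool) (j : 'I_n) :
  (forall i l, (v i ord0 l <= B)%N) ->
  coordinator B eps (transcript B v sent) j = estimate eps v sent j.
Proof.
move=> vB; apply: eq_bigr => i _.
rewrite /transcript decode_entriesK// decode_F2K// big_map big_enum_cond/=.
(* Among the decoded entries of site [i], at most one has index [j], and it is there exactly when it
   was sent. *)
rewrite (eq_bigl (fun l => (l == j) && sent i j)).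
  by rewrite big_mkcondr big_pred1_eq mulr_natr mulrb.
by move=> l; rewrite inE val_eqE andbC; case: eqP => // ->.
Qed.

(** * Sending probabilities and weights *)

Section send_prob.
Variables (R : realType) (eps : R).
Hypothesis eps_gt0 : 0 < eps.

(** The bound [a ^ 2 <= f] holds for an entry [a] of a vector with [F2] equal to [f]; it forces [f]
    to be positive, so the quotient is a genuine one. *)
Lemma send_prob_gt0 (a f : nat) : (0 < a)%N -> (a ^ 2 <= f)%N ->
  0 < send_prob eps a f.
Proof.
move=> a0 af; have f0 : (0 < f)%N by apply: leq_trans af; rewrite expn_gt0 a0.
by rewrite /send_prob lt_min ltr01 divr_gt0 ?mulr_gt0 ?exprn_gt0 ?ltr0n.
Qed.

Lemma weightM_send_prob (a f : nat) : (a ^ 2 <= f)%N ->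
  weight eps a f * send_prob eps a f = a%:R.
Proof.
case: (posnP a) => [-> _|a0 af]; first by rewrite /weight !mul0r.
by rewrite divfK// gt_eqF// send_prob_gt0.
Qed.

Lemma weight_variance (a f : nat) : (a ^ 2 <= f)%N ->
  weight eps a f ^+ 2 * (send_prob eps a f * (1 - send_prob eps a f))
  <= eps ^+ 2 / 3 * f%:R.
Proof.
move=> af; have rhs0 : 0 <= eps ^+ 2 / 3 * f%:R.
  by rewrite mulr_ge0// divr_ge0// sqr_ge0.
have [a0|a0] := posnP a; first by rewrite /weight a0 mul0r expr0n mul0r.
have f0 : (0 < f)%N by apply: leq_trans af; rewrite expn_gt0 a0.
have p0 := send_prob_gt0 a0 af.
have [p1|p1] := leP 1 (3 * a%:R ^+ 2 / (eps ^+ 2 * f%:R)).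
  by rewrite /send_prob (min_l p1) subrr !mulr0.
have pE : send_prob eps a f = 3 * a%:R ^+ 2 / (eps ^+ 2 * f%:R).
  by rewrite /send_prob min_r// ltW.
rewrite mulrA; apply: (@le_trans _ _ (weight eps a f ^+ 2 * send_prob eps a f)).
  apply: ler_piMr; first by rewrite mulr_ge0 ?sqr_ge0// ltW.
  by rewrite gerBl ltW.
(* With [p < 1], weight^2 p = weight * a = a^2 / p, which is exactly eps^2 f / 3. *)
rewrite expr2 -mulrA weightM_send_prob// /weight pE le_eqVlt; apply/orP; left.
by apply/eqP; field; rewrite ?gt_eqF ?ltr0n ?exprn_gt0.
Qed.

(** Each minimum is at most its second argument, and the squares in the numerators add up to [F2 x],
    which cancels unless it is zero. *)
Lemma sum_send_prob_le (n : nat) (x : 'rV[nat]_n) :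
  \sum_(j < n) send_prob eps (x ord0 j) (F2 x) <= 3 / eps ^+ 2.
Proof.
apply: (@le_trans _ _
  (\sum_(j < n) (x ord0 j)%:R ^+ 2 * (3 / (eps ^+ 2 * (F2 x)%:R)))).
  apply: ler_sum => j _; rewrite /send_prob [leRHS]mulrA [_ * 3]mulrC.
  by rewrite ge_min lexx orbT.
rewrite -mulr_suml; under eq_bigr do rewrite -natrX.
rewrite -natr_sum -/(F2 x); have [->|F0] := posnP (F2 x).
  by rewrite mul0r divr_ge0// sqr_ge0.
rewrite le_eqVlt; apply/orP; left.
by apply/eqP; field; rewrite ?gt_eqF ?ltr0n.
Qed.

End send_prob.

Lemma entry_sqr_le_F2 (n : nat) (x : 'rV[nat]_n) (j : 'I_n) :
  (x ord0 j ^ 2 <= F2 x)%N.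
Proof. by rewrite /F2 (bigD1 j)//= leq_addr. Qed.

(** * Logarithmic bounds on the field widths *)

Lemma up_log2_ln_le (R : realType) (n : nat) : (1 < n)%N ->
  (up_log 2 n)%:R * ln 2 <= 2 * ln n%:R :> R.
Proof.
move=> n1; have n0 : (0 < n)%N by exact: ltnW.
(* Rounding the logarithm up costs less than one factor 2, and [2 <= n]; this is the source of the
   factor 2 in the bound. *)
have h : (2 ^ up_log 2 n <= n ^ 2)%N.
  have := up_log_gtn (isT : (1 < 2)%N) n1.
  rewrite -[X in (2 ^ X <= _)%N]prednK ?up_log_gt0// expnS => /ltnW h.
  by rewrite expnS expn1 leq_mul.
rewrite !mulr_natl -!lnXn ?ltr0n// ler_ln ?posrE ?exprn_gt0 ?ltr0n//.
by rewrite -!natrX ler_nat.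
Qed.

Lemma width_le (n a m : nat) : (m < n ^ a)%N -> (width m <= a * up_log 2 n)%N.
Proof.
move=> h; apply: up_log_min => //; rewrite mulnC expnM; apply: leq_trans h _.
by case: a => // a; rewrite leq_exp2r// up_logP.
Qed.

(** The widest field is that of [F2]: its values are at most n * B^2 <= n^(2c+1), and one more power
    of [n] makes the inequality strict, as [width_le] requires. *)
Lemma widths_le (c n B : nat) : (1 < n)%N -> (B <= n ^ c)%N ->
  let w := ((2 * c).+2 * up_log 2 n)%N in
  [/\ (index_width n <= w)%N, (entry_width B <= w)%N & (F2_width n B <= w)%N].
Proof.
move=> n1 Bn /=; have n0 : (0 < n)%N by exact: ltnW.
split; apply: width_le.
- by rewrite -[X in (X < _)%N]expn1 ltn_exp2l.
- apply: (leq_ltn_trans Bn).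
  by rewrite ltn_exp2l// ltnS mul2n -addnn (leq_trans (leq_addr c c)).
- apply: (@leq_ltn_trans (n ^ (2 * c).+1)); last by rewrite ltn_exp2l.
  by rewrite [leqRHS]expnS leq_mul2l [(2 * c)%N]mulnC expnM leq_exp2r// Bn orbT.
Qed.

(** * Accuracy and expected cost of the protocol *)

Section protocol.
Context (R : realType) (d : measure_display) (T : measurableType d).
Variables (P : probability T R) (k n : nat) (eps : R).
Variables (v : 'I_k -> 'rV[nat]_n) (sent : 'I_k -> 'I_n -> {RV P >-> bool}).
Hypotheses (eps_gt0 : 0 < eps) (indep : independent_sending eps v sent).

Let A (ij : 'I_k * 'I_n) : set T := [set t | sent ij.1 ij.2 t]%classic.

Let mA ij : measurable (A ij).
Proof.
rewrite (_ : A ij = sent ij.1 ij.2 @^-1` [set true])%classic; last exact/funext.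
exact: measurable_funPTI.
Qed.

Let indicA ij t : \1_(A ij) t = (sent ij.1 ij.2 t)%:R :> R.
Proof.
by rewrite indicE; congr (nat_of_bool _)%:R; apply/idP/idP; rewrite inE.
Qed.

Let p (ij : 'I_k * 'I_n) := send_prob eps (v ij.1 ord0 ij.2) (F2 (v ij.1)).

Let PA ij : P (A ij) = (p ij)%:E.
Proof. by case: ij => i j; exact: indep.1. Qed.

Let PAA ij kl : ij != kl -> P (A ij `&` A kl)%classic = (p ij * p kl)%:E.
Proof.
(* Pairwise independence is mutual independence for a two-element set. *)
move=> ne; have := indep.2 [set ij; kl].
rewrite (_ : [set t | _]%classic = (A ij `&` A kl)%classic); last first.
  apply/seteqP; split => t /= h.
    by split; apply: h; rewrite !inE eqxx ?orbT.
  by move=> mn; rewrite !inE => /orP[] /eqP ->; case: h.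
by move=> ->; rewrite big_setU1 ?inE//= big_set1 EFinM -!PA.
Qed.

Lemma estimate_concentration (j : 'I_n) :
  ((2 / 3)%:E <=
    P [set t | (`|estimate eps v (fun i l => sent i l t) j
                  - (\sum_(i < k) v i ord0 j)%N%:R|
                <= eps * ell2' R v)%R]%classic)%E.
Proof.
pose X t := \sum_i weight eps (v i ord0 j) (F2 (v i)) * \1_(A (i, j)) t.
have XE t : estimate eps v (fun i l => sent i l t) j = X t.
  by apply: eq_bigr => i _; rewrite indicA.
have mX : measurable_fun [set: T] X by exact: measurable_indic_sum.
have EX : ('E_P[X] = (\sum_(i < k) v i ord0 j)%N%:R%:E)%E.
  rewrite (@expectation_indic_sum _ _ _ _ _ _ (fun i => p (i, j)))//.
  rewrite natr_sum; congr EFin; apply: eq_bigr => i _.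
  by rewrite weightM_send_prob// entry_sqr_le_F2.
pose S : R := \sum_(i < k) (F2 (v i))%:R.
have ell : ell2' R v = Num.sqrt S.
  congr Num.sqrt; apply: eq_bigr => i _; rewrite natr_sum.
  by apply: eq_bigr => l _; rewrite natrX.
have VX : ('V_P[X] <= (eps ^+ 2 / 3 * S)%:E)%E.
  rewrite (@variance_indic_sum _ _ _ _ _ _ (fun i => p (i, j)))//; last first.
    by move=> i i' ii'; apply: PAA; rewrite xpair_eqE negb_and ii'.
  rewrite lee_fin mulr_sumr; apply: ler_sum => i _.
  by rewrite weight_variance// entry_sqr_le_F2.
have S0 : 0 <= S by apply: sumr_ge0.
under eq_set do rewrite XE.
(* If [S = 0] the radius is 0 and Chebyshev does not apply, but then all vectors vanish and the
   estimate is exact. *)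
move: S0; rewrite le_eqVlt => /predU1P[S0|S0].
  have v0 i : F2 (v i) = 0%N.
    apply/eqP; rewrite -(pnatr_eq0 R); apply/eqP.
    by move/esym: S0 => /psumr_eq0P; apply.
  rewrite (_ : [set t | _]%classic = setT) ?probability_setT.
    by rewrite lee_fin ler_pdivrMr// mul1r ler_nat.
  apply/seteqP; split => // t _ /=; rewrite ell -S0 sqrtr0 mulr0.
  have v0j i : v i ord0 j = 0%N.
    by have := entry_sqr_le_F2 (v i) j; rewrite v0 leqn0 expn_eq0 andbT => /eqP.
  rewrite /X big1 => [|i _]; last by rewrite /weight v0j !mul0r.
  by rewrite big1 ?subrr ?normr0.
apply: le_trans (chebyshev_within mX _ EX VX); last first.
  by rewrite ell mulr_gt0// sqrtr_gt0.
(* The ratio of the variance bound eps^2 S / 3 to the squared radius eps^2 S is 1/3. *)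
rewrite lee_fin ell exprMn sqr_sqrtr ?(ltW S0)// le_eqVlt.
by apply/orP; left; apply/eqP; field; rewrite !gt_eqF.
Qed.

Lemma expected_communication (c B : nat) :
  (1 < n)%N -> eps < 1 -> (B <= n ^ c)%N -> (forall i j, v i ord0 j <= B)%N ->
  ('E_P[(fun t => (communication
           (transcript B v (fun i j => sent i j t)))%:R)%R]
   <= (16 * (2 * c).+2%:R / ln 2 * (k%:R * ln n%:R / eps ^+ 2))%R%:E)%E.
Proof.
move=> n1 eps_lt1 Bn vB.
have [iw ew fw] := widths_le n1 Bn; set w := (_ * _)%N in iw ew fw.
have E0 : 0 < eps ^+ 2 by rewrite exprn_gt0.
pose s : R := (index_width n + entry_width B)%:R.
pose h : R := k%:R * (index_width n + F2_width n B)%:R.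
pose Y t : R := \sum_ij s * \1_(A ij) t.
(* The cost is a deterministic part [h], the headers of all sites, plus [s] bits for each entry
   sent. *)
have comE : (fun t => (communication
    (transcript B v (fun i j => sent i j t)))%:R : R) = cst h \+ Y.
  apply/funext => t /=; rewrite /communication natr_sum /Y.
  rewrite -(pair_bigA _ (fun i j => s * \1_(A (i, j)) t)) /=.
  rewrite /h mulr_natl -[X in _ *+ X]card_ord -sumr_const -big_split.
  apply: eq_bigr => i _; rewrite size_site_message// natrD natrM mulrC.
  congr (_ + _).
  rewrite -mulr_sumr; congr (s * _); under eq_bigr do rewrite indicA.
  rewrite -natr_sum -sum1_card big_mkcond; congr (_%:R).
  by apply: eq_bigr => j _; rewrite inE.
rewrite comE expectationD ?Lfun_cst//; last first.
  by apply/Lfun1_integrable; exact: integrable_indic_sum.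
rewrite expectation_cst (expectation_indic_sum _ mA PA) -EFinD lee_fin.
have sw : s <= 2 * w%:R by rewrite mulr_natl mulr2n -natrD ler_nat leq_add.
(* Since [eps < 1], dividing by [eps ^+ 2] only increases the header cost, which then has the same
   form as the cost of the entries. *)
have hw : h <= k%:R * (2 * w%:R / eps ^+ 2).
  rewrite /h ler_wpM2l// ler_pdivlMr//.
  apply: (@le_trans _ _ (index_width n + F2_width n B)%:R).
    by rewrite ler_piMr// exprn_ile1 ?(ltW eps_gt0) ?(ltW eps_lt1).
  by rewrite mulr_natl mulr2n -natrD ler_nat leq_add.
have pk : \sum_ij p ij <= k%:R * (3 / eps ^+ 2).
  rewrite -(pair_bigA _ (fun i j => p (i, j))) /=.
  rewrite mulr_natl -[X in _ *+ X]card_ord -sumr_const.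
  by apply: ler_sum => i _; exact: (sum_send_prob_le eps_gt0 (v i)).
have p0 : 0 <= \sum_ij p ij.
  by apply: sumr_ge0 => ij _; rewrite -lee_fin -PA.
rewrite -mulr_sumr.
(* Here 8 = 2 + 2 * 3: two header fields, and two fields for each of at most 3 / eps^2 expected
   entries per site. *)
apply: (@le_trans _ _ (k%:R * (8 * w%:R / eps ^+ 2))).
  apply: le_trans (lerD hw (ler_pM _ p0 sw pk)) _ => //.
  by rewrite le_eqVlt; apply/orP; left; apply/eqP; field; rewrite gt_eqF.
have ln2 : 0 < ln 2 :> R by rewrite ln_gt0// ltr1n.
(* The factor 2 from [up_log2_ln_le] turns 8 into the final 16, and [ln 2] comes from the change of
   base. *)
have wl : w%:R <= 2 * (2 * c).+2%:R * ln n%:R / ln 2 :> R.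
  rewrite ler_pdivlMr// /w natrM -mulrA -mulrA [leRHS]mulrCA ler_wpM2l//.
  exact: up_log2_ln_le.
apply: (@le_trans _ _
  (k%:R * (8 * (2 * (2 * c).+2%:R * ln n%:R / ln 2) / eps ^+ 2))).
  by rewrite ler_wpM2l// ler_wpM2r ?invr_ge0 ?(ltW E0)// ler_wpM2l.
by rewrite le_eqVlt; apply/orP; left; apply/eqP; field; rewrite !gt_eqF.
Qed.

End protocol.

Theorem theorem2 (R : realType) (B : nat -> nat) (c : nat)
    (hB : forall n : nat, (1 < n)%N -> (B n <= n ^ c)%N) :
  exists C : R, 0 < C /\
  forall (k n : nat) (eps : R) (v : 'I_k -> 'rV[nat]_n)
    (d : measure_display) (T : measurableType d) (P : probability T R)
    (sent : 'I_k -> 'I_n -> {RV P >-> bool}),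
    (0 < k)%N -> (1 < n)%N -> 0 < eps -> eps < 1 ->
    (forall i j, (v i ord0 j <= B n)%N) ->
    independent_sending eps v sent ->
    let run (t : T) (i : 'I_k) (j : 'I_n) : bool := sent i j t in
    [/\ forall (t : T) (j : 'I_n),
          coordinator (B n) eps (transcript (B n) v (run t)) j
          = estimate eps v (run t) j,
        forall j : 'I_n,
          ((2 / 3)%:E <=
           P [set t | (`|estimate eps v (run t) j - (\sum_(i < k) v i ord0 j)%N%:R|
                         <= eps * ell2' R v)%R]%classic)%E
      & ('E_P[fun t => (communication (transcript (B n) v (run t)))%:R%R]
         <= (C * (k%:R * ln n%:R / eps ^+ 2))%R%:E)%E].
Proof.
have ln2 : 0 < ln 2 :> R by rewrite ln_gt0// ltr1n.
(* The constant depends only on the exponent [c] of the polynomial bound on the entries. *)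
exists (16 * (2 * c).+2%:R / ln 2); split; first by rewrite divr_gt0 ?mulr_gt0.
move=> k n eps v d T P sent _ n1 eps_gt0 eps_lt1 vB indep run; split.
- by move=> t j; exact: coordinator_transcript.
- by move=> j; exact: estimate_concentration.
- by apply: expected_communication => //; exact: hB.
Qed.
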